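(* Fix an integer $k\ge 2$. There exists a triple $(M,\pi_0,\mathcal L)$, where (1) $M=(S,A,T,R,\gamma)$ is an MDP with $|S|=2$ and $|A|=k$, (2) $\pi_0:S\to A$ is a policy for $M$, and (3) $\mathcal L$ is a policy iteration (PI) algorithm, such that if $\mathcal L$ is initialised at $\pi_0$ and executed on $M$, it visits all the $k^2$ policies for $M$.
   Context: A (finite, discounted) MDP is a tuple $(S,A,T,R,\gamma)$ with finite state set $S$; finite action set $A$ (all actions available at every state); transition function $T:S\times A\times S\to[0,1]$ with $\sum_{s'}T(s,a,s')=1$; reward function $R:S\times A\to\mathbb R$; and discount factor $\gamma\in[0,1)$. A policy is a map $\pi:S\to A$. Its value function $V^\pi:S\to\mathbb R$ is the unique solution of $V^\pi(s)=R(s,\pi(s))+\gamma\sum_{s'}T(s,\pi(s),s')V^\pi(s')$. The action value function is $Q^\pi(s,a)=R(s,a)+\gamma\sum_{s'}T(s,a,s')V^\pi(s')$ and the gain is $\rho^\pi(s,a)=Q^\pi(s,a)-V^\pi(s)$. The improvable set is $I^\pi=\{(s,a):\rho^\pi(s,a)>0\}$. A valid improvement set is a nonempty $I\subseteq I^\pi$ containing at most one pair $(s,a)$ for each $s\in S$. A policy improvement step from $\pi$ using $I$ yields the policy $\pi'$ with $\pi'(s)=a$ if $(s,a)\in I$ and $\pi'(s)=\pi(s)$ otherwise. A PI algorithm, started at a policy $\pi_0$, produces a sequence $\pi_0,\pi_1,\dots,\pi_\ell$, each $\pi_{i+1}$ being obtained from $\pi_i$ by a policy improvement step with a valid improvement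 set $I\subseteq I^{\pi_i}$ of the algorithm's choosing, and stops when $I^{\pi_\ell}=\emptyset$. The policies visited are $\pi_0,\dots,\pi_\ell$. *)

(* Defs.v *)
From HB Require Import structures.
From mathcomp Require Import all_boot all_order all_algebra.
From mathcomp Require Import boolp reals.

Set Implicit Arguments.
Unset Strict Implicit.
Unset Printing Implicit Defensive.

Import Order.TTheory GRing.Theory Num.Theory.
Local Open Scope ring_scope.

Record mdp (R : realType) : Type := Mdp {
  state : finType;
  action : finType;
  trans : state -> action -> state -> R;
  reward : state -> action -> R;
  discount : R;
  trans_itv : forall s a s', 0 <= trans s a s' <= 1;
  trans_sum1 : forall s a, \sum_(s' : state) trans s a s' = 1;
  discount_itv : 0 <= discount < 1 }.

Definition policy (R : realType) (M : mdp R) : Type :=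
  {ffun state M -> action M}.

HB.instance Definition _ (R : realType) (M : mdp R) :=
  Finite.copy (policy M) {ffun state M -> action M}.

Section Values.
Variables (R : realType) (M : mdp R).
Implicit Types (pi : policy M) (s : state M) (a : action M).
Implicit Types (V W : {ffun state M -> R}) (I : {set state M * action M}).

(* The right-hand side of the Bellman equations, with continuation values V. *)
Definition lookahead V s a : R :=
  reward s a + discount M * \sum_(s' : state M) trans s a s' * V s'.

Definition bellman pi V : Prop := forall s, V s = lookahead V s (pi s).

Lemma discounted_fixpoint0 pi (v : state M -> R) :
    (forall s, v s = discount M * \sum_(s' : state M) trans s (pi s) s' * v s') ->
  forall s, v s = 0.
Proof.
move=> hv s0; have /andP[g0 g1] := discount_itv M.
pose m := [arg max_(i > s0) `|v i|]%O.
have hm : forall j, `|v j| <= `|v m|.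
  by rewrite /m; case: arg_maxP => // i _ hi j; apply: hi.
have h : `|v m| <= discount M * `|v m|.
  rewrite {1}hv normrM ger0_norm // ler_wpM2l //.
  apply: le_trans (ler_norm_sum _ _ _) _.
  rewrite -[leRHS]mul1r -(trans_sum1 m (pi m)) mulr_suml.
  apply: ler_sum => j _; have /andP[t0 _] := trans_itv m (pi m) j.
  by rewrite normrM ger0_norm // ler_wpM2l.
have vm0 : `|v m| <= 0.
  have : (1 - discount M) * `|v m| <= 0 by rewrite mulrBl mul1r subr_le0.
  by rewrite pmulr_rle0 // subr_gt0.
by apply/eqP; rewrite -normr_le0 (le_trans (hm s0)).
Qed.

Lemma bellman_unique pi V W : bellman pi V -> bellman pi W -> V = W.
Proof.
move=> hV hW; apply/ffunP => s; apply/eqP; rewrite -subr_eq0; apply/eqP.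
apply: (@discounted_fixpoint0 pi (fun s => V s - W s)) => {}s.
rewrite [in LHS]hV [in LHS]hW /lookahead opprD addrACA subrr add0r -mulrBr -sumrB.
by congr (_ * _); apply: eq_bigr => j _; rewrite mulrBr.
Qed.

Lemma bellman_exists pi : exists V, bellman pi V.
Proof.
pose n := #|state M|.
pose P := \matrix_(i < n, j < n)
  trans (enum_val j) (pi (enum_val j)) (enum_val i) : 'M[R]_n.
pose A := 1%:M - discount M *: P.
have PE (u : 'rV[R]_n) s : (u *m P) 0 (enum_rank s) =
    \sum_(s' : state M) trans s (pi s) s' * u 0 (enum_rank s').
  rewrite mxE (reindex_onto (@enum_rank _) enum_val) /=; last first.
    by move=> i _; rewrite enum_valK.
  apply: eq_big => [i|i _]; first by rewrite enum_rankK eqxx.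
  by rewrite mxE !enum_rankK mulrC.
have Au : A \in unitmx.
  rewrite -row_free_unit -kermx_eq0; apply/rowV0P => u /sub_kermxP.
  rewrite mulmxBr mulmx1 -scalemxAr => /eqP; rewrite subr_eq0 => /eqP hu.
  apply/rowP => i; rewrite mxE -[i]enum_valK.
  apply: (@discounted_fixpoint0 pi (fun s => u 0 (enum_rank s))) => s.
  by rewrite -PE {1}hu mxE.
pose r := \row_(i < n) reward (enum_val i) (pi (enum_val i)) : 'rV[R]_n.
pose u := r *m invmx A.
have hu : u = r + discount M *: (u *m P).
  have : u *m A = r by rewrite mulmxKV.
  by rewrite mulmxBr mulmx1 -scalemxAr => <-; rewrite subrK.
exists [ffun s => u 0 (enum_rank s)] => s; rewrite ffunE {1}hu.
rewrite mxE [r _ _]mxE [X in _ + X]mxE PE enum_rankK.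
by rewrite /lookahead; under [in RHS]eq_bigr do rewrite ffunE.
Qed.

(* By bellman_unique, this is the only solution. *)
Definition value pi : {ffun state M -> R} := sval (cid (bellman_exists pi)).

Lemma valueP pi : bellman pi (value pi).
Proof. exact: svalP. Qed.

Definition qvalue pi s a : R := lookahead (value pi) s a.

Definition gain pi s a : R := qvalue pi s a - value pi s.

Definition improvable pi : {set state M * action M} :=
  [set sa | 0 < gain pi sa.1 sa.2].

Definition valid_improvement pi I : Prop :=
  [/\ I != set0, I \subset improvable pi
    & forall s a a', (s, a) \in I -> (s, a') \in I -> a = a'].

Definition improve pi I : policy M :=
  [ffun s => odflt (pi s) [pick a | (s, a) \in I]].

End Values.

(* A rule, applicable to every MDP, that selects a valid improvement set from *)
(* the list h of policies visited previously (oldest first) and the current   *)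
(* policy pi; nothing is required of the selection when pi is not improvable. *)
Record pi_algorithm (R : realType) : Type := PiAlgorithm {
  select : forall M : mdp R,
    seq (policy M) -> policy M -> {set state M * action M};
  select_valid : forall (M : mdp R) (h : seq (policy M)) (pi : policy M),
    improvable pi != set0 -> valid_improvement pi (select h pi) }.

(* With h already visited and current policy pi, L goes on to produce exactly *)
(* the policies in t and then stops.                                          *)
Fixpoint continues (R : realType) (L : pi_algorithm R) (M : mdp R)
    (h : seq (policy M)) (pi : policy M) (t : seq (policy M)) : Prop :=
  match t with
  | [::] => improvable pi = set0
  | pi' :: t' =>
      [/\ improvable pi != set0, pi' = improve pi (select L h pi)
        & continues L (rcons h pi) pi' t']
  end.

Definition execution (R : realType) (L : pi_algorithm R) (M : mdp R)
    (pi0 : policy M) (p : seq (policy M)) : Prop :=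
  exists2 t, p = pi0 :: t & continues L [::] pi0 t.

Lemma card_policy (R : realType) (M : mdp R) :
  #|{: policy M}| = (#|action M| ^ #|state M|)%N.
Proof. exact: card_ffun. Qed.

(* Main.v *)
Require Import Defs.
From mathcomp Require Import all_boot all_order all_algebra.
From mathcomp Require Import reals.
From mathcomp Require Import boolp.
From mathcomp Require Import zify ring lra.

(* Number the actions so that one state owns the even ranks and the other the *)
(* odd ones. Higher ranks pay less, but leave their state with geometrically  *)
(* smaller probability. At a policy using ranks x and y, the difference of    *)
(* the two state values is (y - x) over a quantity dominated by the leaving   *)
(* probability of the smaller rank, and the sign of the gain of a switch      *)
(* depends only on that difference. So while the larger rank is kept, each    *)
(* climb of the other state to its next rank below the larger one improves;   *)
(* once the two ranks are adjacent, dropping the larger one to the bottom     *)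
(* (rank 0 or 1) improves, and the sweep restarts with the roles of the       *)
(* states exchanged and one rank fewer.                                       *)

Set Implicit Arguments.
Unset Strict Implicit.
Unset Printing Implicit Defensive.

Import Order.TTheory GRing.Theory Num.Theory.

(** A policy is a point [(a, b)] of an [n.+1] by [n.+1] grid, and the walk peels off the shells
    where [maxn a b] is constant: from [(0, m)] along one side to [(m, m)], jump to [(m, 0)], along
    the other side to [(m, m-1)], jump to [(0, m-1)]. Every move switches one state: sides are paid
    for by [climb_gain], jumps by [drop_gain], and [rank01_gain_le0] stops the walk at [(0, 0)].
    [mem_tour] gives coverage; [execution_of_path] turns any path of improving switches ending at an
    optimum into an execution. *)

Section Algorithms.
Variable R : realType.

(** Bundling the rule with its validity lets both be transported together along an equality of
    MDPs. *)
Definition selection (M : mdp R) : Type :=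
  {f : seq (policy M) -> policy M -> {set state M * action M} |
    forall h pi, improvable pi != set0 -> valid_improvement pi (f h pi)}.

Lemma valid_improvement1 (M : mdp R) (pi : policy M) sa :
  sa \in improvable pi -> valid_improvement pi [set sa].
Proof.
move=> sa_imp; split; first by apply/set0Pn; exists sa; rewrite set11.
  by rewrite sub1set.
by move=> s a a'; rewrite !inE => /eqP <- /eqP[].
Qed.

(** When [f] proposes nothing improvable, any improvable pair is taken, so validity holds at every
    history. *)
Definition preferring (M : mdp R)
    (f : seq (policy M) -> policy M -> option (state M * action M)) :
  selection M.
Proof.
exists (fun h pi =>
  if [pick sa in improvable pi | f h pi == Some sa] is Some sa then [set sa]
  else if [pick sa in improvable pi] is Some sa then [set sa] else set0).
move=> h pi imp; case: pickP => [sa /andP[sa_imp _]|_].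
  exact: valid_improvement1.
case: pickP => [sa|none]; first exact: valid_improvement1.
by case/set0Pn: imp => sa; rewrite none.
Defined.

Lemma preferringE (M : mdp R) f h (pi : policy M) sa :
  f h pi = Some sa -> sa \in improvable pi ->
  sval (preferring f) h pi = [set sa].
Proof.
move=> fE sa_imp /=; case: pickP => [sb|/(_ sa)]; last by rewrite sa_imp fE eqxx.
by rewrite fE => /andP[_ /eqP[->]].
Qed.

(** An algorithm must act on all MDPs: a classical test of equality with [M] transports [f], and
    proof irrelevance makes the transport at [M] trivial. *)
Lemma algorithm_on (M : mdp R) (f : selection M) :
  exists L : pi_algorithm R, forall h pi, select L (M := M) h pi = sval f h pi.
Proof.
pose sel M' : selection M' :=
  match pselect (M = M') with
  | left e => eq_rect M selection f M' e
  | right _ => preferring (fun _ _ => None)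
  end.
exists (PiAlgorithm (fun M' => svalP (sel M'))) => h pi /=.
rewrite /sel; case: pselect => [e|//].
by rewrite (Prop_irrelevance e erefl).
Qed.

Definition improving_switch (M : mdp R) (pi pi' : policy M) : bool :=
  [exists sa in improvable pi, improve pi [set sa] == pi'].

Lemma execution_of_path (M : mdp R) (pi0 : policy M) t :
  path (@improving_switch M) pi0 t -> improvable (last pi0 t) = set0 ->
  exists L, execution L pi0 (pi0 :: t).
Proof.
(* The length of the history serves as a clock pointing into [t]. *)
pose target (h : seq (policy M)) := nth pi0 t (size h).
pose f h pi := [pick sa in improvable pi | improve pi [set sa] == target h].
have [L LE] := algorithm_on (preferring f).
suff follow h (pi : policy M) s : drop (size h) t = s ->
    path (@improving_switch M) pi s -> improvable (last pi s) = set0 ->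
    continues L h pi s.
  by move=> pt optimal; exists L; exists t => //; apply: follow; rewrite ?drop0.
elim: s h pi => [|pi' s IHs] h pi dropE //= /andP[sw ps] optimal.
have targetE : target h = pi' by rewrite /target -[size h]addn0 -nth_drop dropE.
have /exists_inP[sa sa_imp /eqP saE] := sw.
have [sb fE [sb_imp sbE]] : exists2 sb, f h pi = Some sb
    & sb \in improvable pi /\ improve pi [set sb] = pi'.
  rewrite /f targetE; case: pickP => [sb /andP[? /eqP ?]|/(_ sa)].
    by exists sb.
  by rewrite sa_imp saE eqxx.
split; first by apply/set0Pn; exists sa.
  by rewrite LE (preferringE fE) ?sbE.
by apply: IHs; rewrite ?size_rcons -1?add1n -?drop_drop ?dropE /= ?drop0.
Qed.

End Algorithms.

(** * The two-state MDP and its gains *)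

Section Zigzag.
Local Open Scope ring_scope.
Variables (R : realType) (n : nat).

Definition rank (s : bool) (a : nat) : nat := (s + a.*2)%N.

Definition leave (x : nat) : R := 3 ^- x.

(* One minus the discount factor: at most leave x for every rank x in use. *)
Definition slack : R := leave n.+1.*2.

Lemma leave_gt0 x : 0 < leave x.
Proof. by rewrite invr_gt0 exprn_gt0. Qed.

Lemma leave_add x y : leave (x + y) = leave x * leave y.
Proof. by rewrite /leave exprD invfM. Qed.

Lemma leave_le x y : (x <= y)%N -> leave y <= leave x.
Proof. by move=> xy; rewrite lef_pV2 ?posrE ?exprn_gt0 // ler_weXn2l ?ler1n. Qed.

Lemma leave_le1 x : leave x <= 1.
Proof. by rewrite (le_trans (leave_le (leq0n x))) // /leave expr0 invr1. Qed.

Lemma slack_le : slack <= 1 / 9.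
Proof.
have -> : 1 / 9 = leave 2 by rewrite /leave; field.
exact: leave_le.
Qed.

Lemma zigzag_discount_itv : 0 <= 1 - slack < 1.
Proof.
have c1 := slack_le; have c0 : 0 < slack := leave_gt0 _.
by apply/andP; split; lra.
Qed.

Definition zigzag_trans (s : bool) (a : 'I_n.+1) (s' : bool) : R :=
  if s' == s then 1 - leave (rank s a) else leave (rank s a).

Lemma zigzag_trans_itv s a s' : 0 <= zigzag_trans s a s' <= 1.
Proof.
rewrite /zigzag_trans; have := leave_gt0 (rank s a).
by have := leave_le1 (rank s a); case: ifP => _ ? ?; apply/andP; split; lra.
Qed.

Lemma zigzag_trans_sum1 s a : \sum_(s' : bool) zigzag_trans s a s' = 1.
Proof. by rewrite big_bool /zigzag_trans; case: s => /=; ring. Qed.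

Definition zigzag : mdp R :=
  Mdp (fun s (a : 'I_n.+1) => - (rank s a)%:R)
    zigzag_trans_itv zigzag_trans_sum1 zigzag_discount_itv.

Definition switch_gain (x y z : nat) : R :=
  x%:R - z%:R + (1 - slack) * (leave x - leave z) *
    ((y%:R - x%:R) / (slack + (1 - slack) * (leave x + leave y))).

Lemma denominator_gt0 x y : 0 < slack + (1 - slack) * (leave x + leave y).
Proof.
have c0 : 0 < slack := leave_gt0 _; have c1 := slack_le.
rewrite addr_gt0 // mulr_gt0 //; first by lra.
by rewrite addr_gt0 ?leave_gt0.
Qed.

Lemma gain_zigzag (pi : policy zigzag) (s : bool) (a : 'I_n.+1) :
  gain pi s a =
  switch_gain (rank s (pi s)) (rank (~~ s) (pi (~~ s))) (rank s a).
Proof.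
have lookaheadE (v : {ffun bool -> R}) (r : bool) (i : 'I_n.+1) :
    lookahead (M := zigzag) v r i = - (rank r i)%:R + (1 - slack) *
      ((1 - leave (rank r i)) * v r + leave (rank r i) * v (~~ r)).
  rewrite /lookahead /= big_bool /zigzag_trans.
  by congr (_ + _ * _); case: r => //=; rewrite addrC.
have Vs := valueP pi s; have Vt := valueP pi (~~ s).
rewrite /gain /qvalue; move: Vs Vt; rewrite !lookaheadE negbK /switch_gain.
set x := rank s (pi s); set y := rank _ (pi _); set z := rank s a.
have := denominator_gt0 x y; move: (value pi s) (value pi (~~ s)) => v w.
move: (leave x) (leave y) (leave z) slack x%:R y%:R z%:R => p q r c X Y Z.
move=> d0 vE wE.
(* Subtract the two Bellman equations. *)
have -> : (Y - X) / (c + (1 - c) * (p + q)) = v - w.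
  apply: (mulIf (lt0r_neq0 d0)); rewrite divfK ?lt0r_neq0 //.
  lra.
lra.
Qed.

Lemma climb_gain x y : (x.+3 <= y)%N -> (y < n.+1.*2)%N ->
  0 < switch_gain x y x.+2.
Proof.
move=> xy yn; rewrite /switch_gain.
have px := leave_gt0 x; have c0 : 0 < slack := leave_gt0 _.
have c1 := slack_le.
have E2 : leave x.+2 = leave x / 9.
  by rewrite -addn2 leave_add; congr (_ * _); rewrite /leave; field.
have y3 : leave y <= leave x / 27.
  apply: le_trans (leave_le xy) _.
  by rewrite -addn3 leave_add; rewrite [leave 3](_ : _ = 27^-1) // /leave; field.
have c27 : slack <= leave x / 27.
  apply: le_trans y3; exact/leave_le/ltnW.
have d0 := denominator_gt0 x y.
have xyR : x%:R + 3 <= y%:R :> R by rewrite -natrD ler_nat addn3.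
rewrite -addn2 natrD addn2 E2 mulrA opprD addrA subrr add0r addrC subr_gt0.
rewrite ltr_pdivlMr //.
(* The gap is at least 3 and [8 / 9] is the relative fall of [leave]; the result must exceed twice
   the denominator, 2 being the reward lost. *)
have : 3 * ((1 - slack) * (leave x * (8 / 9))) <=
   (1 - slack) * (leave x - leave x / 9) * (y%:R - x%:R).
  rewrite mulrC ler_pM ?mulr_ge0 //; lra || nra.
nra.
Qed.

(** The reward rises, and the state of lower value is left at least as often. *)
Lemma drop_gain x y z : (y <= x)%N -> (z < x)%N -> 0 < switch_gain x y z.
Proof.
move=> yx zx; rewrite /switch_gain ltr_pwDl ?subr_gt0 ?ltr_nat //.
rewrite -mulrA -[X in _ * X]mulrNN -mulNr !opprB.
have c1 := slack_le; have d0 := denominator_gt0 x y.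
rewrite mulr_ge0 //; first by lra.
rewrite mulr_ge0 ?subr_ge0 ?leave_le 1?ltnW //.
by rewrite divr_ge0 ?subr_ge0 ?ler_nat ?ltW.
Qed.

(** By parity a genuine switch costs at least 2 in reward, while the value term is at most 1. *)
Lemma rank01_gain_le0 x y z :
  (x < 2)%N -> (y < 2)%N -> odd z = odd x -> switch_gain x y z <= 0.
Proof.
move=> x2 y2 zx; have [<-|z_neq_x] := eqVneq x z.
  by rewrite /switch_gain !subrr mulr0 mul0r addr0.
have xz : (x.+2 <= z)%N by lia.
have d0 := denominator_gt0 x y; have c1 := slack_le.
have c0 : 0 < slack := leave_gt0 _.
have px := leave_gt0 x; have py := leave_gt0 y; have pz := leave_gt0 z.
have lxz : leave z <= leave x by apply: leave_le; lia.
have xzR : x%:R + 2 <= z%:R :> R by rewrite -natrD ler_nat addn2.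
have xyR : y%:R - x%:R <= 1 :> R by rewrite lerBlDl natr1 ler_nat; lia.
rewrite /switch_gain mulrA addrC -lerBrDr opprB add0r ler_pdivrMr //.
have : (1 - slack) * (leave x - leave z) * (y%:R - x%:R) <= (1 - slack) * leave x.
  by rewrite -mulrA ler_wpM2l //; [lra|nra].
nra.
Qed.

(* State false uses rank 2 a and state true rank 2 b + 1, for u = (a, b). *)
Definition zigzag_policy (u : nat * nat) : policy zigzag :=
  [ffun s => inord (if s then u.2 else u.1) : 'I_n.+1].

(** * The walk through the grid of policies *)

Definition next (u : nat * nat) : nat * nat :=
  let: (a, b) := u in
  if (a < b)%N then (a.+1, b) else if a == b then (a, 0%N)
  else if (b.+1 < a)%N then (a, b.+1) else (0%N, b).

(** [next] fixes [(0, 0)], and beyond [n] the [inord] in [zigzag_policy] is no longer faithful. *)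
Definition follows : rel (nat * nat) :=
  [rel u v | [&& u != (0, 0)%N, maxn u.1 u.2 <= n & v == next u]%N].

Lemma follows_improving u v :
  follows u v -> improving_switch (zigzag_policy u) (zigzag_policy v).
Proof.
case: u => a b /and3P[/= u_neq0 ab_le_n /eqP->].
have [a_le_n b_le_n] : (a <= n)%N /\ (b <= n)%N by lia.
have rE s : rank s (zigzag_policy (a, b) s) = rank s (if s then b else a).
  by rewrite ffunE inordK //; case: s.
have switch (s : bool) (i : nat) w : (i <= n)%N ->
    zigzag_policy w =
      [ffun r => if r == s then inord i else zigzag_policy (a, b) r] ->
    0 < switch_gain (rank s (if s then b else a))
      (rank (~~ s) (if ~~ s then b else a)) (rank s i) ->
    improving_switch (zigzag_policy (a, b)) (zigzag_policy w).
  move=> i_le_n wE g0; apply/exists_inP; exists (s, inord i : 'I_n.+1).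
    by rewrite inE /= gain_zigzag !rE inordK.
  apply/eqP; rewrite wE; apply/ffunP => r; rewrite !ffunE.
  have [->|r_neq_s] := eqVneq r s.
    case: pickP => [j|/(_ (inord i))]; last by rewrite inE eqxx.
    by rewrite inE => /eqP[].
  case: pickP => //= j; rewrite inE => /eqP[rs].
  by rewrite rs eqxx in r_neq_s.
rewrite /next; case: ltngtP => [ab|ab|eq_ab].
- apply: (switch false a.+1); first by lia.
    by apply/ffunP => -[]; rewrite !ffunE.
  by apply: climb_gain; rewrite /rank /=; lia.
- case: ifP => ba.
    apply: (switch true b.+1); first by lia.
      by apply/ffunP => -[]; rewrite !ffunE.
    by apply: climb_gain; rewrite /rank /=; lia.
  apply: (switch false 0%N) => //.
    by apply/ffunP => -[]; rewrite !ffunE.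
  by apply: drop_gain; rewrite /rank /=; lia.
rewrite xpair_eqE in u_neq0; subst b; apply: (switch true 0%N) => //.
  by apply/ffunP => -[]; rewrite !ffunE.
by apply: drop_gain; rewrite /rank /=; lia.
Qed.

Lemma last_optimal : improvable (zigzag_policy (0, 0)%N) = set0.
Proof.
apply/setP => -[s a]; rewrite !inE /= gain_zigzag !ffunE /=.
apply/negbTE; rewrite -leNgt !if_same inordK //.
by apply: rank01_gain_le0; rewrite /rank; case: s; rewrite //= ?oddD !odd_double.
Qed.

(** The starting point [(0, m)] is left out, as [path] expects. *)
Fixpoint tour (m : nat) : seq (nat * nat) :=
  if m is l.+1 then
    [seq (a, m) | a <- iota 1 m] ++ [seq (m, b) | b <- iota 0 m] ++
    (0%N, l) :: tour l
  else [::].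

Lemma path_iota (T : Type) (e : rel T) (f : nat -> T) i l :
  (forall j, (i <= j < i + l)%N -> e (f j) (f j.+1)) ->
  path e (f i) (map f (iota i.+1 l)).
Proof.
elim: l i => //= l IHl i ef; rewrite ef; last by lia.
by apply: IHl => j ij; apply: ef; lia.
Qed.

Lemma last_iota (T : Type) (f : nat -> T) i l :
  last (f i) (map f (iota i.+1 l)) = f (i + l)%N.
Proof.
by elim: l i => [|l IHl] i /=; rewrite ?addn0 // IHl addSnnS.
Qed.

Lemma tour_path m : (m <= n)%N -> path follows (0%N, m) (tour m).
Proof.
elim: m => // m IHm m_lt_n.
rewrite /tour -/tour cat_path (path_iota (f := fun a => (a, m.+1))); last first.
  move=> j /andP[_ jm]; apply/and3P; split; rewrite /next /= ?xpair_eqE //.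
  - by lia.
  - by lia.
  by rewrite ifT //; lia.
rewrite (last_iota (fun a => (a, m.+1))) add0n /= cat_path.
rewrite (path_iota (f := fun b => (m.+1, b))); last first.
  move=> j /andP[_ jm]; apply/and3P; split; rewrite /next //=; first by lia.
  by case: ltngtP => [||]; [lia|rewrite ifT|lia].
rewrite (last_iota (pair m.+1) 0 m) add0n /= IHm ?(ltnW m_lt_n) // !andbT.
apply/andP; split; apply/and3P; split; rewrite /next /= ?ltnn ?eqxx //.
- by lia.
- by lia.
by rewrite !ifF //; lia.
Qed.

Lemma last_tour m : last (0%N, m) (tour m) = (0, 0)%N.
Proof. by elim: m => // m IHm; rewrite /tour -/tour catA last_cat. Qed.

Lemma mem_tour m a b :
  (a <= m)%N -> (b <= m)%N -> (a, b) \in (0%N, m) :: tour m.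
Proof.
elim: m => [|m IHm]; first by case: a; case: b.
move=> am bm; rewrite /tour -/tour inE !mem_cat.
have [->|b_neq] := eqVneq b m.+1.
  case: a am {IHm} => [|a] am; first by rewrite eqxx.
  by rewrite (map_f (fun a => (a, m.+1))) ?orbT // mem_iota; lia.
have [->|a_neq] := eqVneq a m.+1.
  by rewrite (map_f (fun b => (m.+1, b))) ?orbT // mem_iota; lia.
by rewrite IHm ?orbT //; lia.
Qed.

End Zigzag.

Theorem proposition2 (R : realType) (k : nat) (hk : (2 <= k)%N) :
  exists (M : mdp R) (pi0 : policy M) (L : pi_algorithm R),
    [/\ #|state M| = 2, #|action M| = k
      & exists2 p : seq (policy M), execution L pi0 p
          & forall pi : policy M, pi \in p].
Proof.
case: k hk => // n _.
pose pol := @zigzag_policy R n.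
have [L exec] :
    exists L, execution L (pol (0%N, n)) (map pol ((0%N, n) :: tour n)).
  apply: execution_of_path; last by rewrite last_map last_tour last_optimal.
  exact: (homo_path (@follows_improving R n)) (tour_path (leqnn n)).
exists (zigzag R n), (pol (0%N, n)), L; split; rewrite /= ?card_bool ?card_ord //.
exists (map pol ((0%N, n) :: tour n)) => // pi.
have -> : pi = pol (pi false : nat, pi true : nat).
  by apply/ffunP => -[]; rewrite ffunE inord_val.
by apply/map_f/mem_tour; rewrite -ltnS ltn_ord.
Qed.
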